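(* Let $0\le p\le 1/2$. Let $\{C_{(n)}\}$ be a sequence of binary linear $(n,n-k_n)$ codes such that $\text{Prob}\{\text{Detection Error}\}\le 2^{-k_n}$ for $C_{(n)}$ over a binary symmetric channel with error probability $p$, that is, $$\sum_{\mathbf{e}\in C_{(n)},\ \mathbf{e}\ne \mathbf{0}}p^{\text{wt}(\mathbf{e})}(1-p)^{n-\text{wt}(\mathbf{e})}\le 2^{-k_n}\quad\text{for all }n,$$ and such that $\lim_{n\to\infty} k_n/n$ exists and satisfies $\lim_{n\to\infty} k_n/n<\log_2\frac{1}{1-p}$. Let $A'_i$ be the number of codewords of weight $i$ in the dual code $C_{(n)}^{\perp}$. Then $$\sum_{i=1}^{n}A'_i(1-2p)^i\to 0\quad\text{as }n\to\infty.$$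
   Context: A binary linear $(n,m)$ code is an $m$-dimensional subspace of $\mathbb{F}_2^n$; its dual is the orthogonal subspace with respect to the standard bilinear form over $\mathbb{F}_2$. $\text{wt}(\mathbf{e})$ denotes the number of nonzero entries of $\mathbf{e}$. The probability of detection error of a linear code over a binary symmetric channel with error probability $p$ is the probability that the error vector (i.i.d. coordinates, each equal to $1$ with probability $p$) is a nonzero codeword. *)

(* Defs.v *)
From HB Require Import structures.
From mathcomp Require Import all_boot all_order all_algebra.
From mathcomp Require Import all_classical all_reals all_analysis.

Set Implicit Arguments.
Unset Strict Implicit.
Unset Printing Implicit Defensive.

Import Order.TTheory GRing.Theory Num.Theory.
Import numFieldNormedType.Exports.

Local Open Scope ring_scope.

Definition dotv (F : fieldType) (n : nat) (u v : 'rV[F]_n) : F :=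
  \sum_(i < n) u 0 i * v 0 i.

Lemma dotv_bilinear (F : fieldType) (n : nat) :
  bilinear_for (GRing.Scale.Law.clone _ _ *%R _)
    (GRing.Scale.Law.clone _ _ (@idfun F \; *%R) _) (@dotv F n).
Proof.
split=> [v | v] a x y /=; rewrite /dotv mulr_sumr -big_split /=;
  by apply: eq_bigr => i _; rewrite !mxE ?mulrDl ?mulrDr ?mulrA // [v 0 i * a]mulrC.
Qed.

HB.instance Definition _ (F : fieldType) (n : nat) :=
  bilinear_isBilinear.Build F 'rV[F]_n 'rV[F]_n F _ _ (@dotv F n)
    (dotv_bilinear F n).

Lemma dotv_sym (F : fieldType) (n : nat) (u v : 'rV[F]_n) :
  dotv u v = (-1) ^+ false * idfun (dotv v u).
Proof. by rewrite expr0 mul1r; apply: eq_bigr => i _; rewrite mulrC. Qed.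

HB.instance Definition _ (F : fieldType) (n : nat) :=
  isHermitianSesquilinear.Build F 'rV[F]_n false idfun (@dotv F n)
    (@dotv_sym F n).

Definition dual_code (F : fieldType) (n : nat) (C : {vspace 'rV[F]_n}) :
  {vspace 'rV[F]_n} := orthov (@dotv F n) C.

Lemma mem_dual_codeP (F : fieldType) (n : nat) (C : {vspace 'rV[F]_n})
    (u : 'rV[F]_n) :
  reflect {in C, forall v, dotv u v = 0} (u \in dual_code C).
Proof. exact: mem_orthovP. Qed.

Definition wt (F : fieldType) (n : nat) (e : 'rV[F]_n) : nat :=
  #|[set i : 'I_n | e 0 i != 0]|.

Definition weight_count (n : nat) (C : {vspace 'rV['F_2]_n}) (i : nat) : nat :=
  #|[set e : 'rV['F_2]_n | (e \in C) && (wt e == i)]|.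

(* Each summand is the probability that the error vector of a binary symmetric
   channel, whose coordinates are independent and equal to 1 with probability p,
   is e. *)
Definition detection_error_prob (R : realType) (p : R) (n : nat)
    (C : {vspace 'rV['F_2]_n}) : R :=
  \sum_(e : 'rV['F_2]_n | (e \in C) && (e != 0))
    p ^+ wt e * (1 - p) ^+ (n - wt e).

Definition log2 (R : realType) (x : R) : R := ln x / ln 2.

(* Main.v *)
(* Applied to C with x = 1, y = 1 - 2p, the MacWilliams identity expresses the
   probability that the error vector lies in C (zero vector included) through
   the dual code:
     (1 - p)^n + Prob{Detection Error} = 2^(-k) (1 + sum_i A'_i (1 - 2p)^i).
   The bound on the detection error thus gives
     0 <= sum_i A'_i (1 - 2p)^i <= 2^k (1 - p)^n,
   and the right-hand side decays geometrically because lim k/n is smaller than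
   log2 (1/(1 - p)). *)
Require Import Defs.
From mathcomp Require Import all_boot all_order all_algebra.
From mathcomp Require Import all_classical all_reals all_analysis.
From mathcomp Require Import finfield ring lra.
Import Order.TTheory GRing.Theory Num.Theory.
Import numFieldNormedType.Exports.
Local Open Scope classical_set_scope.
Local Open Scope ring_scope.

(** The sign character of the additive group of ['F_2], with values in any ring. *)
Definition chi2 {R : pzRingType} (a : 'F_2) : R := (-1) ^+ (a : nat).

Lemma chi2D {R : pzRingType} (a b : 'F_2) : chi2 (a + b) = chi2 a * chi2 b :> R.
Proof.
rewrite /chi2; case: a b => [[|[|//]] ?] [[|[|//]] ?] /=;
  by rewrite ?expr0 ?expr1 ?mulr1 ?mul1r ?mulrNN ?mulr1.
Qed.

Lemma chi2_0 {R : pzRingType} : chi2 0 = 1 :> R.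
Proof. by []. Qed.

Lemma chi2_neq0 {R : pzRingType} (a : 'F_2) : a != 0 -> chi2 a = -1 :> R.
Proof. by case: a => [[|[|//]] ?]. Qed.

Lemma chi2_dotv {R : comPzRingType} {n : nat} (u e : 'rV['F_2]_n) :
  chi2 (dotv u e) = \prod_(i < n) chi2 (u 0 i * e 0 i) :> R.
Proof. by rewrite /dotv (big_morph _ chi2D chi2_0). Qed.

Lemma prod_wt {F : fieldType} {R : comPzRingType} {n : nat} (e : 'rV[F]_n)
    (x y : R) :
  \prod_(i < n) (if e 0 i != 0 then y else x) = x ^+ (n - wt e) * y ^+ wt e.
Proof.
rewrite big_if /= !prodr_const mulrC /wt cardsE; congr (_ ^+ _ * _).
have /esym := cardC (fun i : 'I_n => e 0 i != 0).
by rewrite card_ord => /(congr1 (subn^~ #|[pred i | e 0 i != 0]|)); rewrite addKn => <-.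
Qed.

(* The Fourier transform of the product weight u |-> x^(n - wt u) y^(wt u). *)
Lemma sum_chi2_wt {R : comPzRingType} {n : nat} (e : 'rV['F_2]_n) (x y : R) :
  \sum_(u : 'rV['F_2]_n) chi2 (dotv u e) * (x ^+ (n - wt u) * y ^+ wt u)
  = (x + y) ^+ (n - wt e) * (x - y) ^+ wt e.
Proof.
rewrite -prod_wt.
(* Character and weight both factor over the coordinates, so the sum over vectors is a product of
   one-coordinate sums. *)
transitivity (\prod_(i < n) \sum_(a : 'F_2)
    (chi2 (a * e 0 i) * (if a != 0 then y else x))).
  rewrite bigA_distr_bigA /=.
  rewrite (reindex (fun f : {ffun 'I_n -> 'F_2} => \row_i f i)) /=; last first.
    exists (fun u : 'rV_n => [ffun i => u 0 i]) => u _.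
      by apply/ffunP => i; rewrite ffunE mxE.
    by apply/rowP => i; rewrite mxE ffunE.
  apply: eq_bigr => f _; rewrite chi2_dotv -prod_wt -big_split /=.
  by apply: eq_bigr => i _; rewrite mxE.
(* The value 0 contributes [x] and the value 1 contributes [y] with the sign [chi2 (e 0 i)]. *)
apply: eq_bigr => i _.
rewrite (bigD1 0) //= (bigD1 1) //= big1 ?addr0; last first.
  by case=> [[|[|//]] ?].
rewrite mul0r chi2_0 mul1r mul1r /=.
by case: (eqVneq (e 0 i) 0) => [->|/chi2_neq0->]; rewrite ?chi2_0 ?mul1r ?mulN1r.
Qed.

(** Orthogonality of characters: [chi2 (dotv u e)] is a character of [C] in the variable [e],
    trivial exactly when [u] lies in the dual. *)
Lemma sum_chi2_code {R : numDomainType} {n : nat} (C : {vspace 'rV['F_2]_n})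
    (u : 'rV['F_2]_n) :
  \sum_(e in C) chi2 (dotv u e) = if u \in dual_code C then #|C|%:R else 0 :> R.
Proof.
case: (boolP (u \in dual_code C)) => [/mem_dual_codeP uC | /mem_orthovPn[v vC uv]].
  rewrite (eq_bigr (fun=> 1)) => [|e eC]; first by rewrite sumr_const.
  by rewrite uC // chi2_0.
set S := \sum_(e in C) _.
(* Translating the summation variable by v flips every sign. *)
have SN : S = - S.
  rewrite {1}/S (reindex_inj (addrI v)) /= -sumrN.
  apply: eq_big => [e|e _]; first by rewrite rpredDl.
  by rewrite linearDr chi2D chi2_neq0 // mulN1r.
apply/eqP; move/eqP: SN; rewrite -subr_eq0 opprK -mulr2n -mulr_natr mulf_eq0.
by rewrite pnatr_eq0 orbF.
Qed.

(** Poisson summation: each summand is expanded as a Fourier transform, the sums are exchanged, and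
    the inner sum over [C] vanishes off the dual. *)
Lemma macwilliams {R : numDomainType} {n : nat} (C : {vspace 'rV['F_2]_n})
    (x y : R) :
  \sum_(e in C) (x + y) ^+ (n - wt e) * (x - y) ^+ wt e
  = #|C|%:R * \sum_(u in dual_code C) x ^+ (n - wt u) * y ^+ wt u.
Proof.
under eq_bigr => e _ do rewrite -sum_chi2_wt.
rewrite exchange_big /= mulr_sumr [RHS]big_mkcond /=.
apply: eq_bigr => u _; rewrite -mulr_suml sum_chi2_code.
by case: ifP => _ //; rewrite mul0r.
Qed.

Lemma wt0 {F : fieldType} {n : nat} : wt (0 : 'rV[F]_n) = 0%N.
Proof. by apply: eq_card0 => i; rewrite !inE mxE eqxx. Qed.

Lemma wt_eq0 {F : fieldType} {n : nat} (e : 'rV[F]_n) : (wt e == 0%N) = (e == 0).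
Proof.
apply/idP/eqP => [|->]; last by rewrite wt0.
rewrite cards_eq0 => /eqP/setP e0; apply/rowP => i; apply/eqP.
by have := e0 i; rewrite !inE mxE => /negbFE.
Qed.

Lemma wt_le {F : fieldType} {n : nat} (e : 'rV[F]_n) : (wt e <= n)%N.
Proof. by rewrite -[leqRHS]card_ord max_card. Qed.

Lemma sum_weight_count {R : pzRingType} {n : nat} (C : {vspace 'rV['F_2]_n})
    (z : R) :
  \sum_(u in C) z ^+ wt u
  = 1 + \sum_(1 <= i < n.+1) (weight_count C i)%:R * z ^+ i.
Proof.
have wc0 : weight_count C 0 = 1%N.
  rewrite /weight_count cardsE (@fintype.eq_card1 _ 0) // => e.
  by rewrite unfold_in wt_eq0 andbC inE; case: eqP => // ->; rewrite mem0v.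
have -> : 1 + \sum_(1 <= i < n.+1) (weight_count C i)%:R * z ^+ i
    = \sum_(0 <= i < n.+1) (weight_count C i)%:R * z ^+ i.
  by rewrite [RHS]big_ltn // wc0 expr0 mulr1.
rewrite big_mkord.
(* Codewords are grouped by weight; [inord] loses nothing because weights are at most [n]. *)
rewrite (partition_big (fun u => inord (wt u) : 'I_n.+1) predT) //=.
apply: eq_bigr => i _; rewrite mulr_natl /weight_count cardsE -sumr_const.
have wtE (u : 'rV['F_2]_n) : (inord (wt u) == i) = (wt u == i).
  by rewrite -val_eqE /= inordK // ltnS wt_le.
by apply: eq_big => [u|u /andP[_ /eqP <-]]; rewrite ?wtE // inordK // ltnS wt_le.
Qed.

Lemma dual_weight_sum_le {R : realType} {n k : nat} (C : {vspace 'rV['F_2]_n})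
    (p : R) :
  (k <= n)%N -> \dim C = (n - k)%N -> detection_error_prob p C <= 2 ^- k ->
  \sum_(1 <= i < n.+1) (weight_count (dual_code C) i)%:R * (1 - 2 * p) ^+ i
  <= 2 ^+ k * (1 - p) ^+ n.
Proof.
move=> kn dimC errC.
set S := \sum_(1 <= i < n.+1) _.
have pw2 m : (2 : R) ^+ m != 0 by rewrite expf_neq0 // pnatr_eq0.
have PE : (1 - p) ^+ n + detection_error_prob p C = 2 ^- k * (1 + S).
  have := macwilliams C 1 (1 - 2 * p).
  rewrite card_vspace card_Fp // dimC natrX.
  under [in RHS]eq_bigr => u _ do rewrite expr1n mul1r.
  rewrite sum_weight_count -/S => MW.
  (* Scaling by [2 ^+ n] matches the factors [2 * (1 - p)] and [2 * p] that MacWilliams produces,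
     one for each coordinate; the zero codeword gives the term [(1 - p) ^+ n]. *)
  apply: (mulfI (pw2 n)).
  transitivity (2 ^+ (n - k) * (1 + S)); last first.
    by rewrite mulrA -[in 2 ^+ n](subnK kn) exprD mulfK.
  rewrite -MW [RHS](bigD1 0) ?mem0v //= wt0 subn0 expr0 mulr1 mulrDr.
  rewrite -exprMn (_ : 1 + (1 - 2 * p) = 2 * (1 - p)); last by ring.
  congr (_ + _); rewrite mulr_sumr; apply: eq_bigr => e _.
  rewrite (_ : 1 - (1 - 2 * p) = 2 * p); last by ring.
  by rewrite !exprMn -{1}(subnK (wt_le e)) exprD; ring.
(* The bound [2 ^- k] on the error cancels the contribution of the zero dual codeword. *)
have : 2 ^- k * S <= (1 - p) ^+ n.
  by rewrite -(lerD2l (2 ^- k)) -{1}[2 ^- k]mulr1 -mulrDr -PE addrC lerD2r.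
by rewrite ler_pdivrMl // exprn_gt0.
Qed.

Lemma cvg_exp2_mul {R : realType} (k : nat -> nat) (q : R) :
  0 < q -> cvgn (fun n => (k n)%:R / n%:R : R) ->
  limn (fun n => (k n)%:R / n%:R : R) < log2 q^-1 ->
  (fun n => 2 ^+ k n * q ^+ n) @ \oo --> (0 : R).
Proof.
move=> q0 kcvg klim; have ln2 : 0 < ln 2 :> R by rewrite ln_gt0 // ltr1n.
set l := limn _ in klim; pose m := (l + log2 q^-1) / 2.
(* The midpoint [m] leaves room on both sides: eventually [k n / n < m], while [m < log2 q^-1] makes
   the ratio [r], which is 2 to the power [m] times [q], less than 1. *)
have lm : l < m by rewrite /m; lra.
pose r := expR (ln 2 * m + ln q).
have r1 : r < 1.
  rewrite /r; have -> : ln q = - (ln 2 * log2 q^-1).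
    by rewrite /log2 lnV // mulrCA divff ?gt_eqF // mulr1 opprK.
  rewrite expR_lt1 -mulrBr pmulr_rlt0 // /m; lra.
apply: (@squeeze_cvgr _ _ _ _ (fun=> 0) (fun n => r ^+ n)); last 2 first.
- exact: cvg_cst.
- by apply: cvg_expr; rewrite ger0_norm // expR_ge0.
have /cvgr_lt/(_ m lm) := kcvg.
(* Positivity of [n] allows [k n / n < m] to be cleared of its denominator. *)
apply: filterS2 (nbhs_infty_gt 0) => n n0 knm.
apply/andP; split; first by rewrite mulr_ge0 ?exprn_ge0 // ltW.
rewrite /r -expRM_natl mulrDr expRD; apply: ler_pM.
- exact: exprn_ge0.
- by rewrite exprn_ge0 // ltW.
- rewrite mulrCA expRM lnK ?posrE // -powR_mulrn // ler_powR ?ler1n //.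
  by rewrite mulrC -ler_pdivrMr ?ltr0n // ltW.
- by rewrite expRM_natl lnK.
Qed.

Theorem theorem5 (R : realType) (p : R) (k : nat -> nat)
    (C : forall n : nat, {vspace 'rV['F_2]_n})
    (hp : 0 <= p <= 2^-1)
    (hk : forall n : nat, (k n <= n)%N)
    (hdim : forall n : nat, \dim (C n) = (n - k n)%N)
    (herr : forall n : nat, detection_error_prob p (C n) <= 2 ^- k n)
    (hcvg : cvgn (fun n : nat => (k n)%:R / n%:R : R))
    (hlim : limn (fun n : nat => (k n)%:R / n%:R : R) < log2 (1 - p)^-1) :
  (fun n : nat =>
     \sum_(1 <= i < n.+1)
       (weight_count (dual_code (C n)) i)%:R * (1 - 2 * p) ^+ i : R)
    @ \oo --> (0 : R).
Proof.
(* Both signs come from [p <= 2^-1]: the first serves the logarithm, the second makes the dual sum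
   nonnegative. *)
have q0 : 0 < 1 - p by lra.
have z0 : 0 <= 1 - 2 * p by lra.
apply: squeeze_cvgr (cvg_cst _) (cvg_exp2_mul k (1 - p) q0 hcvg hlim).
apply: nearW => n; rewrite dual_weight_sum_le // andbT.
by apply: sumr_ge0 => i _; rewrite mulr_ge0 ?exprn_ge0.
Qed.
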